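(* For every positive integer $n$ and every $0<\epsilon<1$ there is a constant $c_{n,\epsilon}>0$, depending only on $n$ and $\epsilon$, such that the following holds. For every measurable set $K\subset\mathbb{R}$ there is an interval $I\subset\mathbb{R}$ with $|K\cap I|\ge \frac{1-\epsilon}{n}|K|$ such that $$\int_K |p(t)|\,dt \;\ge\; c_{n,\epsilon}\,|K|^{j+1}\sup_{t\in I}|p^{(j)}(t)|$$ for every polynomial $p$ of degree $n$ or less and every $j=0,\ldots,n$ (in particular $I$ does not depend on $p$ or $j$).
   Context: $|\cdot|$ applied to subsets of $\mathbb{R}$ denotes Lebesgue measure; polynomials are in one real variable, and $p^{(j)}$ is the $j$-th derivative. *)

(* Defs.v *)
From HB Require Import structures.
From mathcomp Require Export all_boot all_order all_algebra.
From mathcomp Require Export all_classical all_reals all_analysis.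
Export Order.TTheory GRing.Theory Num.Theory.
Export numFieldNormedType.Exports.

Global Set Implicit Arguments.
Global Unset Strict Implicit.
Global Unset Printing Implicit Defensive.

Global Open Scope classical_set_scope.
Global Open Scope ring_scope.

(** Lebesgue measurability, not Borel measurability: the canonical sigma-algebra
    on a [realType] is the Borel one. The Caratheodory sigma-algebra of the outer
    measure generated by interval length is the domain of
    [completed_lebesgue_measure]; it is the completion of the Borel
    sigma-algebra by [completed_caratheodory_measurable]. *)
Definition lebesgue_measurable (R : realType) (K : set R) : Prop :=
  (((wlength (@idfun R))^*)%mu).-cara.-measurable K.

(** [0 * +oo = 0] in [\bar R]. On a nonempty [I] the supremum is
    nonnegative; on the empty set it would be [-oo]. *)
Definition sup_abs (R : realType) (f : R -> R) (I : set R) : \bar R :=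
  ereal_sup [set `|f t|%:E | t in I].

(* Main.v *)
Require Import Defs.
From mathcomp Require Import qpoly measurable_realfun ring lra.

(** Write [kappa = |K| < oo] and cut the line, from left to right, into node
    ranges [E_0, ..., E_n], each containing a fixed small fraction of the mass of
    [K], separated by [n] gaps, each of mass [(1 - eps) / n * kappa]. For any
    choice of nodes [t_i] in [E_i], let [m] minimise [prod_(k != m) |t_m - t_k|].
    On the gap between [t_m] and its nearest neighbour all the derivatives of all
    the Lagrange basis polynomials at the [t_i] are bounded, since there
    [|x - t_k| <= 2 |t_m - t_k|] for [k != m]. The selected gap depends on the
    nodes, but there are only [n] gaps: were each of them to violate the
    inequality for some polynomial, Chebyshev's inequality would give nodes at
    which these [n] polynomials are all small simultaneously, and the gap
    selected by those nodes would not violate it. For [|K| = oo] a nonzero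
    polynomial has infinite integral over [K], by the finite case applied to its
    top derivative on [K `&` `]-N, N]]. *)

(** * Bounding derivatives on a gap by values at separated nodes *)

Lemma derivnS_mulXsubC (R : comNzRingType) (a : R) (q : {poly R}) (j : nat) :
  (('X - a%:P) * q)^`(j.+1) = ('X - a%:P) * q^`(j.+1) + q^`(j) *+ j.+1.
Proof.
elim: j => [|j IH]; first by rewrite !derivn1 derivM derivXsubC mul1r addrC.
rewrite derivnS IH derivD derivM derivXsubC mul1r -!derivnS derivMn -derivnS.
by rewrite addrAC addrC [_^`(_) *+ _.+2]mulrS addrA [_ + q^`(_)]addrC addrAC.
Qed.

(** Each derivative removes one linear factor, and [d <= B k] pays for the removed factor with one
    power of [d]. The 2 per factor comes from the two terms of the Leibniz rule, each at most [B k]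
    times the inductive bound, up to the factorial. *)
Lemma derivn_prod_XsubC_le (R : realFieldType) (I : Type) (s : seq I)
    (P : pred I) (a B : I -> R) (x d : R) (j : nat) :
  0 < d -> (forall k, P k -> `|x - a k| <= B k) -> (forall k, P k -> d <= B k) ->
  `|(\prod_(k <- s | P k) ('X - (a k)%:P))^`(j).[x]| * d ^+ j
    <= j`!%:R * \prod_(k <- s | P k) (2 * B k).
Proof.
move=> d0 aB dB.
elim: s j => [|k s IH] j.
  rewrite !big_nil; case: j => [|j].
    by rewrite derivn0 hornerC normr1 expr0 fact0 !mulr1.
  by rewrite -[1]/(1%:P) derivnC horner0 normr0 mul0r mulr1 ler0n.
rewrite !big_cons; case: ifP => // Pk.
set q := \prod_(_ <- _ | _) _ in IH *.
set b := \prod_(_ <- _ | _) _ in IH *.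
have B0 : 0 <= B k by exact: le_trans (aB _ Pk).
have b0 : 0 <= b.
  by apply: prodr_ge0 => i Pi; rewrite mulr_ge0// (le_trans _ (aB _ Pi)).
case: j => [|j].
  have := IH 0%N; rewrite !derivn0 !expr0 !mulr1 fact0 !mul1r => {}IH.
  rewrite hornerM hornerXsubC normrM ler_pM// (le_trans (aB _ Pk))//; lra.
rewrite derivnS_mulXsubC hornerD hornerM hornerXsubC hornerMn.
rewrite (le_trans (ler_wpM2r _ (ler_normD _ _))) ?exprn_ge0 ?(ltW d0)//.
have H1 : `|(x - a k) * q^`(j.+1).[x]| * d ^+ j.+1 <= B k * (j.+1`!%:R * b).
  by rewrite normrM -mulrA ler_pM ?aB ?IH ?mulr_ge0 ?exprn_ge0 ?(ltW d0).
have H2 : `|q^`(j).[x] *+ j.+1| * d ^+ j.+1 <= B k * (j.+1`!%:R * b).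
  rewrite normrMn -mulr_natl factS natrM exprSr.
  have := ler_pM (mulr_ge0 (normr_ge0 _) (exprn_ge0 j (ltW d0))) (ltW d0) (IH j)
    (dB _ Pk).
  have : 0 <= j.+1%:R :> R by [].
  nra.
rewrite mulrDl; lra.
Qed.

(** Lagrange interpolation estimated term by term. The order of quantifiers is what matters: [g] is
    read off from the nodes alone, so one gap serves every [p] and [j]. *)
Lemma exists_gap_derivn_le (R : realFieldType) (n : nat) (t : nat -> R) (d : R) :
  (0 < n)%N -> 0 < d ->
  (forall i k, (i < k <= n)%N -> d <= t k - t i) ->
  exists2 g, (g < n)%N & forall (p : {poly R}) (j : nat) (x lam : R),
    (size p <= n.+1)%N -> t g <= x <= t g.+1 ->
    (forall i, (i <= n)%N -> `|p.[t i]| <= lam) ->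
    `|p^`(j).[x]| * d ^+ j <= n.+1%:R * (4 ^+ n * j`!%:R) * lam.
Proof.
move=> n0 d0 td.
have dist (i k : 'I_n.+1) : i != k -> d <= `|t i - t k|.
  move=> ik; case: (ltngtP i k) => [ltik|ltki|/val_inj eik].
  - by rewrite distrC (le_trans _ (ler_norm _))// td// ltik -ltnS /=.
  - by rewrite (le_trans _ (ler_norm _))// td// ltki -ltnS /=.
  - by rewrite eik eqxx in ik.
pose V (i : 'I_n.+1) := \prod_(k < n.+1 | k != i) `|t i - t k|.
have V0 i : 0 < V i.
  by apply: prodr_gt0 => k ki; rewrite (lt_le_trans d0)// dist// eq_sym.
have [m _ mV] := @arg_minP _ _ _ ord0 xpredT V isT.
have [i1 i1m] : exists i1 : 'I_n.+1, i1 != m.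
  exists (if m == ord0 then ord_max else ord0).
  case: ifPn => [/eqP->|]; last by rewrite eq_sym.
  by rewrite -val_eqE /= -lt0n.
have [i0 i0m i0min] := @arg_minP _ _ _ i1 (fun i => i != m) (fun i => `|t m - t i|) i1m.
(* The gap adjacent to [t m] on the side of its nearest node [t i0] lies between these two nodes. *)
have [g gn gP] : exists2 g, (g < n)%N &
    forall x, t g <= x <= t g.+1 -> `|x - t m| <= `|t m - t i0|.
  have [lt|gt|/val_inj e] := ltngtP m i0; last by rewrite e eqxx in i0m.
    have mn : (m < n)%N by rewrite (leq_trans lt)// -ltnS.
    exists m => // x /andP[x1 x2].
    rewrite ger0_norm ?subr_ge0// distrC (le_trans _ (ler_norm _))// lerD2r.
    rewrite (le_trans x2)//; move: lt; rewrite leq_eqVlt => /orP[/eqP->//|lt].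
    by rewrite -subr_ge0 (le_trans (ltW d0))// td// lt /= -ltnS.
  have m0 : (0 < m)%N by rewrite (leq_trans _ gt).
  exists m.-1 => [|x]; first by rewrite prednK// -ltnS.
  rewrite prednK// => /andP[x1 x2].
  rewrite distrC ger0_norm ?subr_ge0// (le_trans _ (ler_norm _))// lerD2l lerN2.
  rewrite (le_trans _ x1)//.
  have : (i0 <= m.-1)%N by rewrite -ltnS prednK.
  rewrite leq_eqVlt => /orP[/eqP->//|lt].
  rewrite -subr_ge0 (le_trans (ltW d0))// td// lt /=.
  by rewrite (leq_trans (leq_pred _))// -ltnS.
exists g => // p j x lam sp /gP xm pl.
(* For [i != m] the factor [k = m] gets the bound [|t m - t i|], which restores the factor [k = i]
   missing from the product. The bounds thus multiply up to a multiple of [V m], whatever [i] is. *)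
pose B (i k : 'I_n.+1) := if k == m then `|t m - t i| else 2 * `|t m - t k|.
have xB (i k : 'I_n.+1) : k != i -> `|x - t k| <= B i k.
  move=> ki; rewrite /B; case: eqP => [km|/eqP km].
    by rewrite km (le_trans xm)// i0min// eq_sym -km.
  rewrite (le_trans (ler_distD (t m) _ _))//.
  have := i0min k km; lra.
have dB (i k : 'I_n.+1) : k != i -> d <= B i k.
  move=> ki; rewrite /B; case: eqP => [km|/eqP km].
    by rewrite -km dist.
  have := dist _ _ km; rewrite distrC.
  have := normr_ge0 (t m - t k); lra.
(* The 4 is the 2 of [derivn_prod_XsubC_le] times the 2 in [B]. Minimality of [V m] then gives
   [V i], the denominator of the basis polynomial. *)
have prodB (i : 'I_n.+1) : \prod_(k < n.+1 | k != i) (2 * B i k) <= 4 ^+ n * V i.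
  apply: (@le_trans _ _ (4 ^+ n * V m)); last first.
    by rewrite ler_pM2l ?exprn_gt0// mV.
  have -> : 4 ^+ n * V m = \prod_(k < n.+1 | k != m) (4 * `|t m - t k|).
    by rewrite big_split /= prodr_const cardC1 card_ord.
  have [->|im] := eqVneq i m.
    apply: ler_prod => k km; rewrite /B (negbTE km).
    have := normr_ge0 (t m - t k); lra.
  rewrite (bigD1 m) 1?eq_sym//= [leRHS](bigD1 i)//=.
  rewrite ler_pM//.
  - by rewrite /B eqxx mulr_ge0.
  - by apply: prodr_ge0 => k /andP[ki km]; rewrite mulr_ge0// (le_trans _ (xB i k _)).
  - rewrite /B eqxx; have := normr_ge0 (t m - t i); lra.
  - rewrite [leRHS](eq_bigl (fun k : 'I_n.+1 => (k != i) && (k != m))); last first.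
      by move=> k; rewrite andbC.
    apply: ler_prod => k /andP[ki km]; rewrite /B (negbTE km).
    have := normr_ge0 (t m - t k); lra.
(* [lagrange_gen] wants an injective sequence of nodes indexed by [nat]. *)
pose y i := t (minn i n) + (i - n)%:R * d.
have yt (i : 'I_n.+1) : y i = t i.
  rewrite /y.
  have /minn_idPl -> : (i <= n)%N by rewrite -ltnS.
  have /eqP -> : (i - n == 0)%N by rewrite subn_eq0 -ltnS.
  by rewrite mul0r addr0.
have y_lt i k : (i < k)%N -> y i < y k.
  move=> ik; rewrite /y; have [kn|nk] := leqP k n.
    have /eqP -> : (k - n == 0)%N by rewrite subn_eq0.
    have /eqP -> : (i - n == 0)%N by rewrite subn_eq0 (leq_trans (ltnW ik)).
    rewrite !mul0r !addr0 -subr_gt0 (lt_le_trans d0)// td//.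
    by rewrite (minn_idPl _) ?ik// (leq_trans (ltnW ik)).
  rewrite ler_ltD//; last first.
    by rewrite ltr_pM2r// ltr_nat ltn_sub2r.
  have [//|ni] := leqP n i.
    by rewrite -subr_ge0 (le_trans (ltW d0))// td// ni /=.
have y_inj : injective y.
  by move=> i k yik; case: (ltngtP i k) => // /y_lt; rewrite yik ltxx//.
have -> : p^`(j).[x] = \sum_(i < n.+1) p.[t i] *
    ((\prod_(k < n.+1 | k != i) (t i - t k))^-1 *
      (\prod_(k < n.+1 | k != i) ('X - (t k)%:P))^`(j).[x]).
  rewrite {1}(lagrange_gen (ltn0Sn n) y_inj sp) (raddf_sum (derivn j)) horner_sum.
  apply: eq_bigr => i _; rewrite lagrangeE// !yt /=.
  rewrite !mul_polyC !derivnZ !hornerZ; congr (_ * (_^-1 * _)).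
    rewrite horner_prod; apply: eq_bigr => k _.
    by rewrite hornerXsubC !yt.
  by congr (_^`(_).[_]); apply: eq_bigr => k _; rewrite yt.
rewrite (le_trans (ler_wpM2r _ (ler_norm_sum _ _ _))) ?exprn_ge0 ?(ltW d0)//.
rewrite mulr_suml.
pose c : R := 4 ^+ n * j`!%:R.
have basis_le (i : 'I_n.+1) : (V i)^-1 *
    `|(\prod_(k < n.+1 | k != i) ('X - (t k)%:P))^`(j).[x]| * d ^+ j <= c.
  rewrite -[leLHS]mulrA ler_pdivrMl//.
  apply: (le_trans (derivn_prod_XsubC_le _ _ d0 (xB i) (dB i))).
  apply: (le_trans (ler_wpM2l _ (prodB i))); first exact: ler0n.
  by rewrite mulrA [_%:R * _]mulrC [leRHS]mulrC.
have term_le (i : 'I_n.+1) : true -> `|p.[t i] *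
    ((\prod_(k < n.+1 | k != i) (t i - t k))^-1 *
      (\prod_(k < n.+1 | k != i) ('X - (t k)%:P))^`(j).[x])| * d ^+ j <= lam * c.
  move=> _; rewrite normrM -[leLHS]mulrA.
  apply: ler_pM (normr_ge0 _) _ _ _; last first.
  - rewrite normrM normfV normr_prod; exact: basis_le.
  - by rewrite pl// -ltnS.
  - by rewrite mulr_ge0// exprn_ge0// ltW.
apply: (le_trans (ler_sum _ term_le)).
by rewrite sumr_const card_ord -[leLHS]mulr_natl -[leRHS]mulrA [lam * _]mulrC.
Qed.

(** Chebyshev's inequality for the sum of the [f i]: otherwise this sum is at least
    [2 * n%:R / delta] on all of [E] and has integral at least [2n], while the hypotheses bound it
    by [n]. *)
Lemma exists_simultaneous_le (R : realType) (d : measure_display)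
    (T : measurableType d) (mu : {measure set T -> \bar R})
    (E : set T) (delta : R) (n : nat) (f : 'I_n -> T -> R) :
  measurable E -> mu E = delta%:E -> 0 < delta -> (0 < n)%N ->
  (forall i t, 0 <= f i t) ->
  (forall i, measurable_fun E (f i)) ->
  (forall i, \int[mu]_(t in E) (f i t)%:E <= 1)%E ->
  exists2 t, E t & forall i, f i t <= 2 * n%:R / delta.
Proof.
move=> mE muE d0 n0 f0 mf intf; apply: contrapT => H.
have Hs t : E t -> 2 * n%:R / delta <= \sum_(i < n) f i t.
  move=> Et; rewrite leNgt; apply/negP => lt; apply: H; exists t => // i.
  rewrite (le_trans _ (ltW lt))// (bigD1 i)//= lerDl.
  exact: sumr_ge0.
have c0 : 0 <= 2 * n%:R / delta by rewrite divr_ge0 ?mulr_ge0 ?(ltW d0).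
have h1 : (\int[mu]_(t in E) (cst (2 * n%:R / delta)%:E) t
    <= \int[mu]_(t in E) \sum_(i < n) (f i t)%:E)%E.
  apply: ge0_le_integral => //.
  - by apply: emeasurable_sum => i; apply/measurable_EFinP; exact: mf.
  - by move=> t Et; rewrite sumEFin lee_fin Hs.
have h2 : (\int[mu]_(t in E) \sum_(i < n) (f i t)%:E <= n%:R%:E)%E.
  rewrite ge0_integral_sum//.
  - rewrite (_ : n%:R%:E = \sum_(i < n) (1 : R)%:E)%E; last first.
      by rewrite sumEFin sumr_const card_ord.
    by apply: lee_sum => i _; exact: intf.
  - by move=> i; apply/measurable_EFinP; exact: mf.
  - by move=> i t _; rewrite lee_fin.
have := le_trans h1 h2.
rewrite integral_cst// muE -EFinM lee_fin divfK ?gt_eqF//.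
have : 0 < n%:R :> R by rewrite ltr0n.
lra.
Qed.

(** * Distribution of the mass of a measurable set along the line *)

Section completed_lebesgue.
Context (R : realType).

Local Notation T := (caratheodory_type (wlength (@idfun R))^*%mu).
Local Notation mu := (@completed_lebesgue_measure R).

Lemma measurable_itv_completed (i : interval R) : measurable ([set` i] : set T).
Proof. by apply: sub_caratheodory; exact: measurable_itv. Qed.

Lemma completed_lebesgue_measure_itvoc (a b : R) :
  a <= b -> mu `]a, b] = (b - a)%:E.
Proof.
(* Both measures unfold to the same outer measure. *)
move=> ab; transitivity (@lebesgue_measure R `]a, b]); first by [].
rewrite lebesgue_measure_itv /= lte_fin; case: ltP => // ba.
by have -> : a = b; [apply/eqP; rewrite eq_le ab|rewrite subrr].
Qed.

Lemma measurable_normr_horner (p : {poly R}) (D : set T) :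
  measurable_fun D ((fun t => `|p.[t]|) : T -> R).
Proof.
have mp : measurable_fun setT (fun t : measurableTypeR R => `|p.[t]| : R).
  apply: continuous_measurable_fun => x; apply: cvg_norm.
  exact: continuous_horner.
move=> mD B mB; apply: measurableI => //; apply: sub_caratheodory.
by have := mp measurableT B mB; rewrite setTI.
Qed.

(** Continuity from below. The form with a strict lower bound [r] serves both finite and infinite
    mass. *)
Lemma exhaustion_lt (K : set R) (r : R) : measurable (K : set T) -> (r%:E < mu K)%E ->
  exists N : R, 0 <= N /\ (r%:E < mu (K `&` `](- N)%R, N]))%E.
Proof.
move=> mK rK; apply: contrapT => /forallNP H.
pose F (i : nat) : set R := K `&` `](- i%:R), i%:R].
have mF i : measurable (F i : set T).
  by apply: measurableI => //; exact: measurable_itv_completed.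
have FK : \bigcup_i F i = K.
  apply/seteqP; split => [x [i _ []]//|x Kx].
  exists (Num.truncn `|x|).+1 => //; split => //=; rewrite in_itv /=.
  have := truncnS_gt `|x|; rewrite ltr_norml => /andP[-> /ltW ->]//.
have ndF : nondecreasing_seq F.
  move=> i j ij; apply/subsetPset => x [Kx]; rewrite /= in_itv /= => /andP[x1 x2].
  split => //=; rewrite in_itv /= (le_trans x2) ?ler_nat// andbT (le_lt_trans _ x1)//.
  by rewrite lerN2 ler_nat.
have cF : mu (F i) @[i --> \oo] --> mu K.
  by rewrite -[in X in _ --> X]FK; apply: nondecreasing_cvg_mu => //; rewrite FK.
suff : (mu K <= r%:E)%E by rewrite leNgt rK.
rewrite -(cvg_lim _ cF)//; apply: lime_le; first by apply/cvg_ex; exists (mu K).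
by near=> i; rewrite leNgt; apply/negP => Hi; apply: (H i%:R); split.
Unshelve. all: by end_near. Qed.

(** [s] is a right inverse of the distribution function [phi] of [K], which is continuous because it
    is 1-Lipschitz; the same property makes cut points at least as far apart as the mass between
    them. The levels 0 and [kappa] are excluded since [phi] may reach them only at infinity. *)
Lemma mass_cut_points (K : set R) (kappa : R) :
  measurable (K : set T) -> mu K = kappa%:E ->
  exists s : R -> R, forall u v, 0 < u -> u <= v -> v < kappa ->
    mu (K `&` `]s u, s v]) = (v - u)%:E /\ v - u <= s v - s u.
Proof.
move=> mK muK.
have mI (i : interval R) : measurable (K `&` [set` i] : set T).
  by apply: measurableI => //; exact: measurable_itv_completed.
have fin (i : interval R) : mu (K `&` [set` i]) \is a fin_num.
  rewrite ge0_fin_numE// (@le_lt_trans _ _ kappa%:E) ?ltry// -muK.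
  by apply: le_measure; rewrite ?inE.
pose phi x := fine (mu (K `&` `]-oo, x])).
have phiB a b : a <= b -> mu (K `&` `]a, b]) = (phi b - phi a)%:E.
  move=> ab.
  have : mu (K `&` `]-oo, b]) = (mu (K `&` `]-oo, a]) + mu (K `&` `]a, b]))%E.
    rewrite -measureU//.
      rewrite -setIUr; congr (mu (_ `&` _)); apply/seteqP.
      split => x /=; rewrite !in_itv /=.
        by case: (leP x a) => xa xb; [left|right].
      by case=> [xa|/andP[]//]; exact: le_trans ab.
    apply/seteqP; split => // x /= [[_ +] [_]]; rewrite !in_itv /= => xa /andP[].
    by rewrite ltNge xa.
  by rewrite EFinB /phi !fineK// => ->; rewrite addeAC subee ?add0e.
have phi_ge0 x : 0 <= phi x by exact: fine_ge0.
have phi_le x : phi x <= kappa.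
  rewrite -lee_fin /phi fineK// -muK; apply: le_measure; rewrite ?inE//.
have phi_nd a b : a <= b -> phi a <= phi b.
  by move=> ab; rewrite -subr_ge0 -lee_fin -phiB.
have phi_lip a b : a <= b -> phi b - phi a <= b - a.
  move=> ab; rewrite -lee_fin -phiB// -completed_lebesgue_measure_itvoc//.
  by apply: le_measure; rewrite ?inE//; exact: measurable_itv_completed.
have phi_cont : continuous phi.
  move=> x; apply/cvgrPdist_le => e e0.
  near=> y.
  have xy : `|x - y| <= e by near: y; exact: cvgr_dist_le.
  apply: le_trans xy.
  have [/[dup] /phi_nd h /phi_lip h'|/ltW /[dup] /phi_nd h /phi_lip h'] := leP x y.
    by rewrite distrC ger0_norm ?subr_ge0// (le_trans h')// distrC ler_norm.
  by rewrite ger0_norm ?subr_ge0// (le_trans h')// ler_norm.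
have phi_onto v : exists s, 0 < v < kappa -> phi s = v.
  have [/andP[v0 vk]|?] := boolP (0 < v < kappa); last by exists 0.
  (* Mass above [v] in the window gives [phi N > v]; mass above [kappa - v] gives
     [phi (- N) < v]. *)
  have [|N [N0]] := @exhaustion_lt K (Num.max v (kappa - v)) mK.
    by rewrite muK lte_fin gt_max vk ltrBlDr ltrDl.
  rewrite phiB ?lte_fin; last lra.
  rewrite gt_max => /andP[Nv Nkv].
  have [|||s _ <-] := @IVT R phi (- N) N v; last by exists s.
  - lra.
  - exact: continuous_subspaceT.
  - have := phi_ge0 (- N); have := phi_le N => h1 h2.
    by rewrite ge_min le_max; apply/andP; split; apply/orP; [left|right]; lra.
have [s sE] := choice phi_onto.
exists s => u v u0 uv vk.
have su : phi (s u) = u by apply: sE; rewrite u0 (le_lt_trans uv).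
have sv : phi (s v) = v by apply: sE; rewrite vk (lt_le_trans u0).
have suv : s u <= s v.
  rewrite leNgt; apply/negP => lt; have := phi_nd _ _ (ltW lt); rewrite su sv => vu.
  have e : u = v by apply/eqP; rewrite eq_le uv.
  by move: lt; rewrite e ltxx.
by split; [rewrite phiB// su sv|rewrite -{1}su -{1}sv phi_lip].
Unshelve. all: by end_near. Qed.

Lemma integral_normr_hornerZ (K : set R) (a : R) (p : {poly R}) :
  measurable (K : set T) ->
  (\int[mu]_(t in K) `|(a *: p).[t]|%:E = `|a|%:E * \int[mu]_(t in K) `|p.[t]|%:E)%E.
Proof.
move=> mK; rewrite -(@ge0_integralZl _ T _ mu K mK (fun t => `|p.[t]|%:E)).
- by apply: eq_integral => t _; rewrite hornerZ normrM.
- by apply/measurable_EFinP; exact: measurable_normr_horner.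
- by move=> t _; rewrite lee_fin.
- by rewrite lee_fin.
Qed.

(** The [n.+3] pieces of mass [dl] are the [n.+1] node ranges and one margin at each end, which
    keeps all cut levels strictly between 0 and [kappa]. *)
Lemma mass_partition (n : nat) (r dl kappa : R) (K : set R) :
  measurable (K : set T) -> mu K = kappa%:E -> 0 < r -> 0 < dl ->
  n%:R * r + n.+3%:R * dl = kappa ->
  exists a b : nat -> R, [/\
    forall i, (i <= n)%N -> mu (K `&` `]a i, b i]) = dl%:E,
    forall g, (g < n)%N -> mu (K `&` `]b g, a g.+1]) = r%:E &
    forall i k, (i < k <= n)%N -> r <= a k - b i].
Proof.
move=> mK muK r0 dl0 kE.
have [s sP] := mass_cut_points mK muK.
pose m (i : nat) := i%:R * (r + dl).
have m_le i k : (i <= k)%N -> 0 <= m i <= m k.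
  move=> ik; rewrite /m mulr_ge0//; last lra.
  by rewrite ler_pM2r ?ler_nat// addr_gt0.
have mn : m n + 3 * dl = kappa by rewrite /m -kE -natr1 -natr1 -natr1; ring.
have mS i : m i.+1 = m i + r + dl by rewrite /m -natr1; ring.
clearbody m; clear kE.
exists (fun i => s (m i + dl)), (fun i => s (m i + 2 * dl)).
split => [i i_n|g gn|i k /andP[ik kn]].
- have /andP[i0 i1] := m_le _ _ i_n.
  by have [||| -> _] := sP (m i + dl) (m i + 2 * dl); [lra..|congr (_%:E); lra].
- have /andP[g0 g1] := m_le _ _ gn; have /andP[g2 _] := m_le _ _ (leqnn g).
  have := mS g => gS.
  by have [||| -> _] := sP (m g + 2 * dl) (m g.+1 + dl); [lra..|congr (_%:E); lra].
- have /andP[k0 k1] := m_le _ _ kn; have /andP[i0 i1] := m_le _ _ ik.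
  have /andP[i2 _] := m_le _ _ (leqnn i).
  have := mS i => iS.
  have [||| _ h] := sP (m i + 2 * dl) (m k + dl); lra.
Qed.

(** * The inequality for finite mass *)

(** Half of what interpolation yields with spacing [(1 - eps) / n * kappa] and node values at most
    [2n / dl], where [dl = eps * kappa / (n + 3)]. The exponent [n] and [n]! cover all [j <= n] at
    once, as [(1 - eps) / n <= 1]; the half makes the next estimate strict. *)
Definition gap_const (n : nat) (eps : R) : R :=
  ((1 - eps) / n%:R) ^+ n * eps
  / (2 * (n.+1%:R * (4 ^+ n * n`!%:R)) * (2 * n%:R) * n.+3%:R).

Lemma gap_const_gt0 (n : nat) (eps : R) :
  (0 < n)%N -> 0 < eps < 1 -> 0 < gap_const n eps.
Proof.
move=> n0 /andP[e0 e1]; have n0' : 0 < n%:R :> R by rewrite ltr0n.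
rewrite divr_gt0// mulr_gt0 ?exprn_gt0 ?divr_gt0//; first lra.
by rewrite !mulr_gt0 ?exprn_gt0 ?ltr0n ?fact_gt0.
Qed.

(** Closes the argument by contradiction: [Q] will be a derivative value of a violating polynomial,
    scaled so that the left-hand side equals 1. *)
Lemma gap_const_spec (n j : nat) (eps kappa Q : R) :
  (0 < n)%N -> 0 < eps < 1 -> 0 < kappa -> (j <= n)%N ->
  Q * ((1 - eps) / n%:R * kappa) ^+ j
    <= n.+1%:R * (4 ^+ n * j`!%:R) * (2 * n%:R / (eps * kappa / n.+3%:R)) ->
  gap_const n eps * kappa ^+ j.+1 * Q < 1.
Proof.
move=> n0 e01 k0 jn; have /andP[e0 e1] := e01.
have n0' : 0 < n%:R :> R by rewrite ltr0n.
set r : R := (1 - eps) / n%:R; set dl := eps * kappa / n.+3%:R.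
have r0 : 0 < r by rewrite divr_gt0//; lra.
have n1 : 1 <= n%:R :> R by rewrite ler1n.
have r1 : r <= 1 by rewrite ler_pdivrMr// mul1r; lra.
have dl0 : 0 < dl by rewrite divr_gt0 ?mulr_gt0.
pose A : R := n.+1%:R * (4 ^+ n * n`!%:R).
have A0 : 0 < A by rewrite !mulr_gt0 ?exprn_gt0 ?ltr0n ?fact_gt0.
have Aj : n.+1%:R * (4 ^+ n * j`!%:R) <= A.
  by rewrite !ler_pM2l ?exprn_gt0// ler_nat leq_fact.
pose c := gap_const n eps; rewrite -/c.
have c0 : 0 < c by exact: gap_const_gt0.
have cE : c * kappa * (A * (2 * n%:R)) * 2 = r ^+ n * dl.
  rewrite /c /gap_const -/r -/A /dl; field.
  by rewrite !gt_eqF// ?ltr0n.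
clearbody r dl; rewrite mulrA ler_pdivlMr// => H.
have rj : r ^+ n <= r ^+ j by rewrite ler_wiXn2l ?(ltW r0).
have rn0 : 0 < r ^+ n * dl by rewrite mulr_gt0 ?exprn_gt0.
have rjdl : r ^+ n * dl <= r ^+ j * dl by rewrite ler_pM2r.
have rj0 : 0 < r ^+ j * dl by exact: lt_le_trans rjdl.
have H' : c * kappa * (Q * (r * kappa) ^+ j * dl) <= c * kappa * (A * (2 * n%:R)).
  rewrite (ler_pM2l (mulr_gt0 c0 k0)); apply: le_trans H _; rewrite ler_wpM2r // mulr_ge0.
rewrite -(ltr_pM2r rj0) mul1r.
have -> : c * kappa ^+ j.+1 * Q * (r ^+ j * dl)
    = c * kappa * (Q * (r * kappa) ^+ j * dl) by rewrite exprMn exprS; ring.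
lra.
Qed.

Lemma exists_interval_finite_mass (n : nat) (eps kappa : R) (K : set R) :
  (0 < n)%N -> 0 < eps < 1 -> measurable (K : set T) ->
  mu K = kappa%:E -> 0 < kappa ->
  exists a b : R, [/\ a <= b,
    (((1 - eps) / n%:R * kappa)%:E <= mu (K `&` `[a, b]))%E &
    forall (p : {poly R}) (j : nat) (x : R),
      (size p <= n.+1)%N -> (j <= n)%N -> a <= x <= b ->
      ((gap_const n eps * kappa ^+ j.+1 * `|p^`(j).[x]|)%:E
        <= \int[mu]_(t in K) `|p.[t]|%:E)%E].
Proof.
move=> n0 e01 mK muK k0; have /andP[e0 e1] := e01.
have n0' : 0 < n%:R :> R by rewrite ltr0n.
pose r := (1 - eps) / n%:R * kappa.
have r0 : 0 < r by rewrite mulr_gt0 ?divr_gt0//; lra.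
pose dl := eps * kappa / n.+3%:R.
have dl0 : 0 < dl by rewrite divr_gt0 ?mulr_gt0.
have [|a [b [nodeE gapE sep]]] := @mass_partition n r dl kappa K mK muK r0 dl0.
  by rewrite /r /dl; field; rewrite !gt_eqF// ltr0n.
have mKI (i : interval R) : measurable (K `&` [set` i] : set T).
  by apply: measurableI => //; exact: measurable_itv_completed.
have ba g : (g < n)%N -> b g <= a g.+1.
  by move=> gn; rewrite -subr_ge0 (le_trans (ltW r0))// sep// leqnn.
apply: contrapT => noI.
(* One violating polynomial per gap, divided by the left-hand side [M] of its failed inequality; [M]
   is positive because it exceeds an integral of a nonnegative function. *)
have /choice[q badq] (g : 'I_n) : exists q : {poly R}, (size q <= n.+1)%N /\
  (exists j x, [/\ (j <= n)%N, b g <= x <= a g.+1,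
    gap_const n eps * kappa ^+ j.+1 * `|q^`(j).[x]| = 1 &
    (\int[mu]_(t in K) `|q.[t]|%:E <= 1)%E]).
  apply: contrapT => noq; apply: noI.
  exists (b g), (a g.+1); split; first exact: ba.
  - rewrite -/r -(gapE g)//; apply: le_measure; rewrite ?inE; [exact: mKI..|].
    move=> y [Ky]; rewrite /= !in_itv /= => /andP[y1 y2]; split => //=.
    by rewrite y2 (ltW y1).
  - move=> p j x sp jn xI; rewrite leNgt; apply/negP.
    set M := gap_const n eps * _ * _ => pM.
    have M0 : 0 < M.
      rewrite -lte_fin (le_lt_trans _ pM)//; apply: integral_ge0 => t _.
      by rewrite lee_fin.
    apply: noq; exists (M^-1 *: p); split.
      by rewrite (leq_trans (size_scale_leq _ _)).
    exists j, x; split => //.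
      rewrite derivnZ hornerZ normrM gtr0_norm ?invr_gt0// mulrCA -/M.
      by rewrite mulVf// gt_eqF.
    rewrite integral_normr_hornerZ// gtr0_norm ?invr_gt0//.
    by rewrite lee_pdivrMl// mule1 ltW.
(* In each node range some point makes all [n] violating polynomials small together. *)
have tP i : exists t, (i <= n)%N ->
    a i < t <= b i /\ forall g, `|(q g).[t]| <= 2 * n%:R / dl.
  have [i_n|] := boolP (i <= n)%N; last by exists 0.
  have [||||g y|g|g|t [Kt tI] tq] := @exists_simultaneous_le R _ T mu
      (K `&` `]a i, b i]) dl n (fun g t => `|(q g).[t]|).
  - exact: mKI.
  - exact: nodeE.
  - exact: dl0.
  - exact: n0.
  - exact: normr_ge0.
  - exact: measurable_normr_horner.
  - have [_ [j [x [_ _ _]]]] := badq g; apply: le_trans.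
    apply: (@ge0_subset_integral _ _ _ mu _ K (mKI _) mK).
    + by apply/measurable_EFinP; exact: measurable_normr_horner.
    + by move=> y _; rewrite lee_fin.
    + exact: subIsetl.
  - by exists t.
have [t tE] := choice tP.
have td i k : (i < k <= n)%N -> r <= t k - t i.
  move=> /andP[ik kn]; have [/andP[ak _] _] := tE k kn.
  have [/andP[_ bi] _] := tE i (ltnW (leq_trans ik kn)).
  by rewrite (le_trans (sep i k _)) ?ik// lerB// ltW.
(* The interval from [t g] to [t g.+1] contains [[b g, a g.+1]], hence the point where [q g]
   violates the inequality. *)
have [g gn gP] := exists_gap_derivn_le n0 r0 td.
have [sq [j [x [jn /andP[x1 x2] q1 _]]]] := badq (Ordinal gn).
have [/andP[_ tg] _] := tE g (ltnW gn); have [/andP[tg1 _] _] := tE _ gn.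
have := gP _ j x _ sq _ (fun i i_n => (tE i i_n).2 (Ordinal gn)).
rewrite (le_trans tg x1) (le_trans x2 (ltW tg1)) => /(_ isT).
by move=> /(gap_const_spec n0 e01 k0 jn); rewrite q1 ltxx.
Qed.

(** * Infinite mass *)

Lemma integral_normr_horner_pinfty (K : set R) (p : {poly R}) :
  measurable (K : set T) -> mu K = +oo%E -> p != 0 ->
  (\int[mu]_(t in K) `|p.[t]|%:E = +oo)%E.
Proof.
move=> mK muK p0; set j := (size p).-1.
have sp : (0 < size p)%N by rewrite size_poly_gt0.
have pj x : p^`(j).[x] = lead_coef p * j`!%:R.
  suff -> : p^`(j) = (lead_coef p * j`!%:R)%:P by rewrite hornerC.
  apply/polyP => -[|i]; rewrite coef_derivn coefC /=.
    by rewrite addn0 ffactnn mulr_natr.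
  by rewrite nth_default ?mul0rn// /j addnS -addSn prednK// leq_addr.
have half : 0 < (2^-1 : R) < 1 by apply/andP; split; lra.
(* The finite case is used with degree bound [size p] instead of the degree [j], so that it is
   positive even for constant [p]; any [eps] would do. *)
pose L := gap_const (size p) 2^-1 * `|lead_coef p * j`!%:R|.
have L0 : 0 < L.
  by rewrite mulr_gt0 ?gap_const_gt0// normr_gt0 mulf_neq0 ?lead_coef_eq0 //
    pnatr_eq0 -lt0n fact_gt0.
apply/eq_infty => y.
(* The summand 1 ensures [kappa >= 1], hence [kappa ^+ j.+1 >= kappa]; the other summand brings
   [L * kappa] above [y]. *)
have [|N [N0 yN]] := @exhaustion_lt K (1 + `|y| / L) mK; first by rewrite muK ltry.
set K' := K `&` _ in yN.
have mN : measurable (`](- N), N] : set T) by exact: measurable_itv_completed.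
have mK' : measurable (K' : set T) by exact: measurableI.
have K'fin : mu K' \is a fin_num.
  rewrite ge0_fin_numE// (@le_lt_trans _ _ (N - - N)%:E) ?ltry//.
  rewrite -completed_lebesgue_measure_itvoc; last lra.
  by apply: le_measure; rewrite ?inE//; exact: subIsetr.
have K'E : mu K' = (fine (mu K'))%:E by rewrite fineK.
set kappa := fine _ in K'E.
rewrite K'E lte_fin in yN.
have yL : 0 <= `|y| / L by rewrite divr_ge0// ltW.
have k1 : 1 <= kappa by lra.
have k0 : 0 < kappa by lra.
have [a [b [ab _ H]]] := exists_interval_finite_mass sp half mK' K'E k0.
have /H : (j <= size p)%N by rewrite leq_pred.
move=> /(_ p a (leqnSn _)).
rewrite lexx ab => /(_ isT) {}H.
apply: (@le_trans _ _ (\int[mu]_(t in K') `|p.[t]|%:E)%E); last first.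
  apply: (@ge0_subset_integral _ _ _ mu K' K mK' mK).
  - by apply/measurable_EFinP; exact: measurable_normr_horner.
  - by move=> t _; rewrite lee_fin.
  - exact: subIsetl.
apply: le_trans H; rewrite lee_fin pj mulrAC -/L.
have kj : kappa <= kappa ^+ j.+1 by rewrite exprS ler_peMr ?(ltW k0)// exprn_ege1.
apply: (@le_trans _ _ (L * (`|y| / L))).
  by rewrite mulrC divfK ?gt_eqF// ler_norm.
by rewrite ler_pM2l//; lra.
Qed.
End completed_lebesgue.

Theorem theorem1 (R : realType) (n : nat) (eps : R) :
  (0 < n)%N -> 0 < eps < 1 ->
  exists2 c : R, 0 < c &
    forall K : set R, lebesgue_measurable K ->
      exists I : set R,
        [/\ is_interval I,
            I !=set0,
            (((1 - eps) / n%:R)%:E * completed_lebesgue_measure K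
               <= completed_lebesgue_measure (K `&` I))%E
          & forall (p : {poly R}) (j : nat), (size p <= n.+1)%N -> (j <= n)%N ->
              (c%:E * completed_lebesgue_measure K ^+ j.+1
                 * sup_abs (fun t => p^`(j).[t]) I
               <= \int[completed_lebesgue_measure]_(t in K) `|p.[t]|%:E)%E].
Proof.
move=> n0 e01; exists (gap_const n eps); first exact: gap_const_gt0.
move=> K mK.
have e1 : 0 <= (1 - eps) / n%:R by rewrite divr_ge0//; case/andP: e01; lra.
have int0 (p : {poly R}) :
    (0 <= \int[completed_lebesgue_measure]_(t in K) `|p.[t]|%:E)%E.
  by apply: integral_ge0 => t _; rewrite lee_fin.
(* For a null set the convention [0 * +oo = 0] makes the left-hand side vanish even if the supremum
   over the whole line is infinite. *)
have [K0|Kn0] := eqVneq (completed_lebesgue_measure K) 0%E.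
  exists setT; split => //.
  - by exists 0.
  - by rewrite K0 mule0.
  - by move=> p j _ _; rewrite K0 expeS mul0e mule0 mul0e.
(* The whole line works again: the integral is infinite unless [p = 0], and then the supremum is 0,
   so the product with the infinite power is 0. *)
have [Koo|Kfin] := eqVneq (completed_lebesgue_measure K) +oo%E.
  exists setT; split => //.
  - by exists 0.
  - by rewrite setIT Koo leey.
  - move=> p j _ _; have [->|p0] := eqVneq p 0; last first.
      by rewrite integral_normr_horner_pinfty// leey.
    rewrite (_ : sup_abs _ _ = 0%E) ?mule0//.
    rewrite /sup_abs (_ : [set _ | _ in _] = [set 0%E]) ?ereal_sup1//.
    apply/seteqP; split => [_ [t _ <-]|_ ->] /=.
      by rewrite linear0 horner0 normr0.
    by exists 0 => //; rewrite linear0 horner0 normr0.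
have KE : completed_lebesgue_measure K = (fine (completed_lebesgue_measure K))%:E.
  by rewrite fineK// ge0_fin_numE// ltey.
set kappa := fine _ in KE.
have k0 : 0 < kappa by rewrite -lte_fin -KE lt0e Kn0 measure_ge0.
have [a [b [ab mass H]]] := exists_interval_finite_mass n0 e01 mK KE k0.
exists `[a, b]%classic; split.
- exact: interval_is_interval.
- by exists a; rewrite /= in_itv /= lexx ab.
- by rewrite KE -EFinM.
move=> p j sp jn; rewrite KE -EFin_expe -EFinM.
have c0 : 0 < gap_const n eps * kappa ^+ j.+1.
  by rewrite mulr_gt0 ?gap_const_gt0 ?exprn_gt0.
(* Dividing by the finite positive factor reduces the bound on the supremum to the pointwise one. *)
rewrite -lee_pdivlMl//; apply: ge_ereal_sup => _ [t tab <-].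
rewrite lee_pdivlMl// -EFinM; apply: H => //.
Qed.
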